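(* Let $n\geq 2$ and let $K\subset\mathbb{C}^n$ be a convex body such that for every complex affine hyperplane $H\subset\mathbb{C}^n$, the section $H\cap K$ is symmetric. Then $K$ is a (complex) ellipsoid.
   Context: A convex body is a compact convex subset of $\mathbb{C}^n$ with nonempty interior. $\mathbb{S}^1=\{\xi\in\mathbb{C}:|\xi|=1\}$. A set $A\subset\mathbb{C}^n$ is called symmetric if there is a translated copy $A'=A-x_0$ of $A$ such that $\xi A'=A'$ for every $\xi\in\mathbb{S}^1$ (the empty set and single points are symmetric). A (complex) ellipsoid in $\mathbb{C}^n$ is the image of the closed Euclidean unit ball under an invertible complex affine map. Hyperplanes are complex hyperplanes (complex dimension $n-1$). *)

(* Defs.v *)
(* C^n is modelled as row vectors 'rV[Cfield R]_n, where R : realType and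
   R[i] = complex R (mathcomp-real-closed).  R[i] is a numFieldType, so
   'rV[R[i]]_n carries the canonical normed (max-norm) topology of
   MathComp-Analysis, which is the usual topology of C^n. *)
From HB Require Import structures.
From mathcomp Require Import all_boot all_order all_algebra.
From mathcomp Require Import complex.
From mathcomp Require Import all_classical all_reals all_analysis.
Set Implicit Arguments. Unset Strict Implicit. Unset Printing Implicit Defensive.
Import Order.TTheory GRing.Theory Num.Theory ComplexField.
Import numFieldTopology.Exports numFieldNormedType.Exports.
Local Open Scope classical_set_scope.
Local Open Scope ring_scope.

(* The complex field C = R[i], seen as a numFieldType so that the
   canonical topology/norm of MathComp-Analysis is found. *)
Definition Cfield (R : realType) : numFieldType := R[i].

Section Defs.
Variables (R : realType) (n : nat).
Local Notation C := (Cfield R).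
Local Notation Cn := 'rV[C]_n.

Definition convex_set_Cn (K : set Cn) : Prop :=
  forall x y : Cn, K x -> K y -> forall t : R, 0 <= t <= 1 ->
    K ((t%:C)%C *: x + (1 - (t%:C)%C) *: y).

Definition convex_body (K : set Cn) : Prop :=
  [/\ convex_set_Cn K, compact K & (K°) !=set0].

Definition complex_hyperplane (H : set Cn) : Prop :=
  exists (a : Cn) (c : C), a != 0 /\
    H = [set z : Cn | \sum_(j < n) a 0 j * z 0 j = c].

(* A is symmetric: some translate A' = A - x0 satisfies xi A' = A'
   for every xi in S^1 (the empty set and points are covered) *)
Definition symmetric_set (A : set Cn) : Prop :=
  exists x0 : Cn, forall xi : C, `|xi| = 1 ->
    (fun y : Cn => xi *: y) @` ((fun a : Cn => a - x0) @` A)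
    = (fun a : Cn => a - x0) @` A.

Definition unit_ball : set Cn :=
  [set v : Cn | \sum_(j < n) `|v 0 j| ^+ 2 <= 1].

Definition complex_ellipsoid (K : set Cn) : Prop :=
  exists (M : 'M[C]_n) (b : Cn), M \in unitmx /\
    K = (fun v : Cn => v *m M + b) @` unit_ball.
End Defs.

(* Main.v *)
Require Import Defs.
From HB Require Import structures.
From mathcomp Require Import all_boot all_order all_algebra.
From mathcomp Require Import complex.
From mathcomp Require Import all_classical all_reals all_analysis.
From mathcomp Require Import ring lra.
Import Order.TTheory GRing.Theory Num.Theory ComplexField.
Import numFieldTopology.Exports numFieldNormedType.Exports.
Local Open Scope classical_set_scope.
Local Open Scope ring_scope.

Set Implicit Arguments. Unset Strict Implicit. Unset Printing Implicit Defensive.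

(* Let f be an affine map of maximal |det| among those mapping K into the unit
   ball B (so f^-1(B) is the Loewner ellipsoid of K), replace K by f(K), and
   let T be the intersection of K with the unit sphere S.  By maximality T lies
   in no complex hyperplane: otherwise one could stretch slightly in the
   direction normal to it and still map K into B.

   If p, q are distinct points of T, let c be the projection of 0 to the complex
   line pq and H a hyperplane containing that line, orthogonal to c and through
   c.  If x0 is the center of H /\ K and d = x0 - c, then the circles about x0
   through p and q stay inside B and touch S at p and q, which forces <d, p - c>
   and <d, q - c> to be real and at least |d|^2.  As p - c and q - c are distinct
   multiples of equal modulus of one vector, d = 0, so the whole circle (chain)
   cut out on S by the line pq lies in T.

   Finally a chain-closed T that spans is all of S.  Seen from a point p of T
   (stereographic projection to the Heisenberg group), the chains of T through p
   are parametrized by a set of directions, and closure under chains makes that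
   set a complex affine subspace. *)

(** * Real coordinates and squared modulus on the complex field *)

Section ComplexScalars.
Variable R : realType.
Local Notation C := (Cfield R).
Implicit Types z w : C.

Definition re z : R := complex.Re z.
Definition im z : R := complex.Im z.
Definition cj z : C := conjc z.
Definition rc (x : R) : C := real_complex R x.
(** Kept real-valued, because the norm [|z|] on [C] is itself an element of [C], which is only
    partially ordered. *)
Definition sqmod z : R := re z ^+ 2 + im z ^+ 2.

Lemma complex_ext z w : re z = re w -> im z = im w -> z = w.
Proof. by case: z w => [a b] [c d]; rewrite /re /im /= => -> ->. Qed.

Lemma re_neq0 z : re z != 0 -> z != 0.
Proof. by apply: contra_neq => ->. Qed.

Lemma reD z w : re (z + w) = re z + re w. Proof. by case: z w => [a b] [c d]. Qed.
Lemma imD z w : im (z + w) = im z + im w. Proof. by case: z w => [a b] [c d]. Qed.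
Lemma reN z : re (- z) = - re z. Proof. by case: z. Qed.
Lemma imN z : im (- z) = - im z. Proof. by case: z. Qed.
Lemma reM z w : re (z * w) = re z * re w - im z * im w.
Proof. by case: z w => [a b] [c d]. Qed.
Lemma imM z w : im (z * w) = re z * im w + im z * re w.
Proof. by case: z w => [a b] [c d]. Qed.
Lemma re0 : re 0 = 0. Proof. by []. Qed.
Lemma im0 : im 0 = 0. Proof. by []. Qed.
Lemma re1 : re 1 = 1. Proof. by []. Qed.
Lemma im1 : im 1 = 0. Proof. by []. Qed.
Lemma re_cj z : re (cj z) = re z. Proof. by case: z. Qed.
Lemma im_cj z : im (cj z) = - im z. Proof. by case: z. Qed.
Lemma re_rc x : re (rc x) = x. Proof. by []. Qed.
Lemma im_rc x : im (rc x) = 0. Proof. by []. Qed.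

Definition reimE := (reD, imD, reN, imN, reM, imM, re0, im0, re1, im1,
  re_cj, im_cj, re_rc, im_rc).

Lemma cjM z w : cj (z * w) = cj z * cj w.
Proof. by apply: complex_ext; rewrite !reimE; ring. Qed.

Lemma cjD z w : cj (z + w) = cj z + cj w.
Proof. by apply: complex_ext; rewrite !reimE //; ring. Qed.

Lemma cjN z : cj (- z) = - cj z.
Proof. by apply: complex_ext; rewrite !reimE. Qed.

Lemma cjK z : cj (cj z) = z.
Proof. by apply: complex_ext; rewrite !reimE ?opprK. Qed.

Lemma cj0 : cj 0 = 0.
Proof. by apply: complex_ext; rewrite !reimE ?oppr0. Qed.

Lemma cj_sum (I : Type) (r : seq I) (F : I -> C) :
  cj (\sum_(i <- r) F i) = \sum_(i <- r) cj (F i).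
Proof. by apply: (big_morph cj cjD cj0). Qed.

Lemma re_sum (I : Type) (r : seq I) (F : I -> C) :
  re (\sum_(i <- r) F i) = \sum_(i <- r) re (F i).
Proof. by apply: (big_morph re reD re0). Qed.

Lemma sqmodM z w : sqmod (z * w) = sqmod z * sqmod w.
Proof. by rewrite /sqmod !reimE; ring. Qed.

Lemma sqmod_ge0 z : 0 <= sqmod z.
Proof. by rewrite addr_ge0 ?sqr_ge0. Qed.

Lemma sqmod_eq0 z : (sqmod z == 0) = (z == 0).
Proof.
rewrite /sqmod paddr_eq0 ?sqr_ge0// !sqrf_eq0; apply/andP/eqP => [[/eqP a /eqP b]|->].
  exact: complex_ext.
by rewrite re0 im0.
Qed.

Lemma sqmod1 : sqmod 1 = 1. Proof. by rewrite /sqmod re1 im1; ring. Qed.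

Lemma sqmodX z k : sqmod (z ^+ k) = sqmod z ^+ k.
Proof. by elim: k => [|k IH]; rewrite ?expr0 ?sqmod1 // !exprS sqmodM IH. Qed.

Lemma sqmodV z : sqmod z^-1 = (sqmod z)^-1.
Proof.
have [->|z0] := eqVneq z 0; first by rewrite invr0 /sqmod re0 im0 !expr0n addr0 invr0.
have s0 : sqmod z != 0 by rewrite sqmod_eq0.
by apply: (mulfI s0); rewrite -sqmodM divff// divff// sqmod1.
Qed.

Lemma mul_cj z : z * cj z = rc (sqmod z).
Proof. by apply: complex_ext; rewrite /sqmod !reimE; ring. Qed.

Lemma rcD x y : rc (x + y) = rc x + rc y.
Proof. by apply: complex_ext; rewrite !reimE ?addr0. Qed.
Lemma rcM x y : rc (x * y) = rc x * rc y.
Proof. by apply: complex_ext; rewrite !reimE; ring. Qed.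
Lemma rc1 : rc 1 = 1. Proof. by []. Qed.
Lemma rc0 : rc 0 = 0. Proof. by []. Qed.
Lemma rc_eq0 x : (rc x == 0) = (x == 0).
Proof. by apply/eqP/eqP => [/(congr1 re)|->]. Qed.
Lemma cj_rc x : cj (rc x) = rc x.
Proof. by apply: complex_ext; rewrite !reimE ?oppr0. Qed.

Lemma sqmod_rc x : sqmod (rc x) = x ^+ 2.
Proof. by rewrite /sqmod re_rc im_rc expr0n addr0. Qed.

Lemma norm_sqr z : `|z| ^+ 2 = rc (sqmod z).
Proof. by rewrite /rc /sqmod add_Re2_Im2. Qed.

Lemma norm_eq1 z : sqmod z = 1 -> `|z| = 1.
Proof.
move=> h; have : `|z| ^+ 2 = 1 by rewrite norm_sqr h.
by move/eqP; rewrite sqrp_eq1 // => /eqP.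
Qed.

End ComplexScalars.

(** * The Hermitian product on [Cn] *)

Section Hermitian.
Variable (R : realType) (n : nat).
Local Notation C := (Cfield R).
Local Notation Cn := 'rV[C]_n.
Implicit Types u v w : Cn.

Definition dot u v : C := \sum_(j < n) u 0 j * cj (v 0 j).
Definition nsq v : R := re (dot v v).

Lemma dotC u v : dot v u = cj (dot u v).
Proof. by rewrite /dot cj_sum; apply: eq_bigr => j _; rewrite cjM cjK mulrC. Qed.

Lemma dotDl u v w : dot (u + v) w = dot u w + dot v w.
Proof. by rewrite /dot -big_split; apply: eq_bigr => j _; rewrite mxE mulrDl. Qed.

Lemma dotZl a u w : dot (a *: u) w = a * dot u w.
Proof. by rewrite /dot mulr_sumr; apply: eq_bigr => j _; rewrite mxE mulrA. Qed.

Lemma dotNl u w : dot (- u) w = - dot u w.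
Proof. by rewrite -scaleN1r dotZl mulN1r. Qed.

Lemma dotBl u v w : dot (u - v) w = dot u w - dot v w.
Proof. by rewrite dotDl dotNl. Qed.

Lemma dotDr u v w : dot w (u + v) = dot w u + dot w v.
Proof. by rewrite dotC dotDl cjD -!dotC. Qed.

Lemma dotZr a u w : dot w (a *: u) = cj a * dot w u.
Proof. by rewrite dotC dotZl cjM -dotC. Qed.

Lemma dotNr u w : dot w (- u) = - dot w u.
Proof. by rewrite dotC dotNl cjN -dotC. Qed.

Lemma dotBr u v w : dot w (u - v) = dot w u - dot w v.
Proof. by rewrite dotDr dotNr. Qed.

Lemma dot0l w : dot 0 w = 0.
Proof. by rewrite -(scale0r 0) dotZl mul0r. Qed.

Lemma dot0r w : dot w 0 = 0.
Proof. by rewrite dotC dot0l cj0. Qed.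

Lemma nsqE v : nsq v = \sum_(j < n) sqmod (v 0 j).
Proof. by rewrite /nsq re_sum; apply: eq_bigr => j _; rewrite mul_cj re_rc. Qed.

Lemma dotvv v : dot v v = rc (nsq v).
Proof.
rewrite nsqE (big_morph (@rc R) (@rcD R) (@rc0 R)); apply: eq_bigr => j _.
exact: mul_cj.
Qed.

Lemma nsq_ge0 v : 0 <= nsq v.
Proof. by rewrite nsqE sumr_ge0 // => j _; exact: sqmod_ge0. Qed.

Lemma nsq_eq0 v : (nsq v == 0) = (v == 0).
Proof.
apply/idP/eqP => [|->]; last by rewrite /nsq dot0l.
rewrite nsqE psumr_eq0; last by move=> j _; exact: sqmod_ge0.
move/allP => h; apply/rowP => j; rewrite mxE; apply/eqP.
by rewrite -sqmod_eq0; apply: h; rewrite mem_index_enum.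
Qed.

Lemma nsq_gt0 v : (0 < nsq v) = (v != 0).
Proof. by rewrite lt_def nsq_ge0 nsq_eq0 andbT. Qed.

Lemma nsqD u v : nsq (u + v) = nsq u + nsq v + 2 * re (dot u v).
Proof. by rewrite /nsq !dotDl !dotDr (dotC u v) !reimE; ring. Qed.

Lemma nsqZ a v : nsq (a *: v) = sqmod a * nsq v.
Proof. by rewrite /nsq dotZl dotZr mulrA mul_cj dotvv !reimE; ring. Qed.

Lemma nsqN v : nsq (- v) = nsq v.
Proof. by rewrite /nsq dotNl dotNr opprK. Qed.

Lemma unit_ballE : @unit_ball R n = [set v | nsq v <= 1].
Proof.
rewrite /unit_ball; apply/funext => v /=; apply/propext.
have -> : \sum_(j < n) `|v 0 j| ^+ 2 = rc (nsq v).
  rewrite nsqE (big_morph (@rc R) (@rcD R) (@rc0 R)); apply: eq_bigr => j _.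
  exact: norm_sqr.
by rewrite -(lecR (nsq v) 1).
Qed.

End Hermitian.

(** * Chains through two contact points *)

Section Chains.
Variable (R : realType) (n : nat).
Local Notation C := (Cfield R).
Local Notation Cn := 'rV[C]_n.
Implicit Types (u v w d e p q z : Cn) (K A : set Cn).

(** One inclusion is enough: used for [xi] and for its inverse, it gives back the equality in
    [symmetric_set]. *)
Definition circled A := exists x0 : Cn, forall y (xi : C),
  A y -> sqmod xi = 1 -> A (x0 + xi *: (y - x0)).

Lemma circled_symmetric_set A : symmetric_set A -> circled A.
Proof.
case=> x0 h; exists x0 => y xi Ay /norm_eq1 /h hx.
have : [set a - x0 | a in A] (xi *: (y - x0)).
  by rewrite -hx; exists (y - x0) => //; exists y.
by case=> a Aa <-; rewrite addrCA subrr addr0.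
Qed.

(** The equation in [complex_hyperplane] is bilinear; conjugating the coefficients makes it
    Hermitian. *)
Lemma complex_hyperplane_dot (a : Cn) (c : C) :
  a != 0 -> complex_hyperplane [set z | dot z a = c].
Proof.
move=> a0; exists (\row_j cj (a 0 j)), c; split; last first.
  by apply/funext => z /=; congr (_ = c); apply: eq_bigr => j _; rewrite mxE mulrC.
apply: contra_neq a0 => /rowP h; apply/rowP => j.
by have := h j; rewrite !mxE => /(congr1 (@cj R)); rewrite cjK cj0.
Qed.

Lemma exists_orthogonal e : (2 <= n)%N -> exists2 a : Cn, a != 0 & dot e a = 0.
Proof.
move=> n2; have n0 : (0 < n)%N by exact: leq_trans n2.
pose i := Ordinal n0; pose k := Ordinal n2.
have [ei|ei] := eqVneq (e 0 i) 0.
  exists (delta_mx 0 i).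
    apply/eqP => /rowP /(_ i) /eqP; rewrite !mxE !eqxx /= oner_eq0 //.
  rewrite /dot big1 // => j _; rewrite mxE eqxx /=.
  by have [->|_] := eqVneq j i; rewrite ?ei ?mul0r // cj0 mulr0.
exists (cj (e 0 i) *: delta_mx 0 k - cj (e 0 k) *: delta_mx 0 i).
  apply/eqP => /rowP /(_ k) /eqP; rewrite !mxE !eqxx /= mulr1 mulr0 subr0.
  by rewrite -sqmod_eq0 /sqmod re_cj im_cj sqrrN sqmod_eq0 (negPf ei).
have dotd j : dot e (delta_mx 0 j) = e 0 j.
  rewrite /dot (bigD1 j) //= mxE !eqxx big1 ?addr0.
    by rewrite (_ : cj _ = 1) ?mulr1 //; apply: complex_ext; rewrite !reimE ?oppr0.
  by move=> l /negPf lj; rewrite mxE eqxx lj cj0 mulr0.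
by rewrite dotBr !dotZr !cjK !dotd mulrC subrr.
Qed.

(** Put g = <d, w - d>. Expanding the squares turns the hypothesis into Re(conj(xi) g) <= Re g; for
    xi = g/|g| this reads |g| <= Re g, so g is real and nonnegative, and <d, w> = |d|^2 + g. *)
Lemma circle_inside_sphere d w :
  (forall xi : C, sqmod xi = 1 -> nsq (d + xi *: (w - d)) <= nsq w) ->
  exists2 x : R, dot d w = rc x & nsq d <= x.
Proof.
move=> h; pose g := dot d (w - d).
have hre xi : sqmod xi = 1 -> re (cj xi * g) <= re g.
  move=> xi1; have := h _ xi1.
  have -> : nsq w = nsq (d + (w - d)) by rewrite addrCA subrr addr0.
  by rewrite (nsqD d) (nsqD d (w - d)) nsqZ xi1 dotZr -/g; lra.
have [gim gre] : im g = 0 /\ 0 <= re g.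
  have [->|g0] := eqVneq g 0; first by [].
  have sg : 0 < sqmod g by rewrite lt_def sqmod_ge0 sqmod_eq0 g0.
  pose r := Num.sqrt (sqmod g).
  have r0 : 0 < r by rewrite sqrtr_gt0.
  have r2 : r ^+ 2 = sqmod g by rewrite sqr_sqrtr ?sqmod_ge0.
  have xi1 : sqmod (g * rc r^-1) = 1.
    by rewrite sqmodM sqmod_rc exprVn r2 divff // gt_eqF.
  have := hre _ xi1; rewrite cjM cj_rc mulrAC (mulrC (cj g)) mul_cj -rcM re_rc.
  rewrite -r2 expr2 mulfK ?gt_eqF // => rg; split; last by lra.
  by move: r2; rewrite /sqmod => r2; apply/eqP; rewrite -sqrf_eq0; apply/eqP; nra.
exists (nsq d + re g); last by lra.
rewrite -[w in LHS](subrK d) dotDr dotvv -/g addrC rcD; congr (_ + _).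
by apply: complex_ext; rewrite ?re_rc ?im_rc.
Qed.

(** Both products <d, l e> and <d, (1 + l) e> are real, at least |d|^2, and of equal modulus, hence
    equal. Their difference is <d, e>, so both vanish and |d|^2 <= 0. *)
Lemma center_unique d e (l : C) :
  sqmod l = sqmod (1 + l) ->
  (forall xi : C, sqmod xi = 1 ->
    nsq (d + xi *: (l *: e - d)) <= nsq (l *: e)) ->
  (forall xi : C, sqmod xi = 1 ->
    nsq (d + xi *: ((1 + l) *: e - d)) <= nsq ((1 + l) *: e)) ->
  d = 0.
Proof.
move=> ll /circle_inside_sphere[x xE dx] /circle_inside_sphere[y yE dy].
have d0 := nsq_ge0 d.
have xy : x = y.
  have : x ^+ 2 = y ^+ 2.
    rewrite -!sqmod_rc -xE -yE !dotZr !sqmodM; congr (_ * _).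
    by move: ll; rewrite /sqmod !re_cj !im_cj !sqrrN.
  by move/eqP; rewrite eqrXn2 // => [/eqP //||]; lra.
have : dot d ((1 + l) *: e) - dot d (l *: e) = 0 by rewrite xE yE xy subrr.
rewrite scalerDl dotDr scale1r addrK => de; apply/eqP.
move: xE; rewrite dotZr de mulr0 => /(congr1 (@re R)); rewrite re_rc re0 => x0.
by rewrite -nsq_eq0 eq_le d0 andbT x0.
Qed.

Lemma chain_closed K : (2 <= n)%N ->
  (forall (a : Cn) (c : C), a != 0 -> circled ([set z | dot z a = c] `&` K)) ->
  (forall v, K v -> nsq v <= 1) ->
  forall p q (s : C), K p -> K q -> nsq p = 1 -> nsq q = 1 -> p != q ->
  nsq (p + s *: (q - p)) = 1 -> K (p + s *: (q - p)).
Proof.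
move=> n2 symK KB p q s Kp Kq p1 q1 pq z1.
pose e := q - p; have e0 : nsq e != 0 by rewrite nsq_eq0 subr_eq0 eq_sym.
have ee : dot e e != 0 by rewrite dotvv rc_eq0.
(* [c] is the foot of the perpendicular from 0 to the line [pq]. Measured along [e] from [c], the
   points [p], [q] and the third one have coordinates [l], [1 + l] and [s + l], of equal modulus
   because all three lie on the unit sphere. *)
pose l : C := dot p e / dot e e; pose c := p - l *: e.
have ce : dot c e = 0 by rewrite dotBl dotZl divfK // subrr.
have pE : p = c + l *: e by rewrite subrK.
have qE : q = c + (1 + l) *: e by rewrite scalerDl addrCA -pE scale1r subrK.
have zE : p + s *: (q - p) = c + (s + l) *: e.
  by rewrite scalerDl addrCA -pE addrC.
have pyth (m : C) : nsq (c + m *: e) = nsq c + sqmod m * nsq e.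
  by rewrite nsqD nsqZ dotZr ce mulr0 re0 mulr0 addr0.
have ll : sqmod l = sqmod (1 + l).
  by apply: (mulIf e0); apply: (@addrI _ (nsq c)); rewrite -!pyth -pE -qE p1.
have lsl : sqmod l = sqmod (s + l).
  by apply: (mulIf e0); apply: (@addrI _ (nsq c)); rewrite -!pyth -pE -zE p1.
have l0 : l != 0.
  apply: contra_eq_neq ll => ->; rewrite addr0 sqmod1.
  by rewrite /sqmod re0 im0 expr0n addr0 eq_sym oner_eq0.
(* [a] is [c] itself unless [c = 0]; in that case any normal orthogonal to [e] works, the last
   clause being trivial. *)
have [a [a0 ea ac]] : exists a : Cn, [/\ a != 0, dot e a = 0 &
    forall z, dot (z - c) a = 0 -> dot (z - c) c = 0].
  have [c0|c0] := eqVneq c 0; last first.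
    by exists c; split => //; rewrite dotC ce cj0.
  have [a a0 ea] := exists_orthogonal e n2; exists a; split => // z _.
  by rewrite c0 dot0r.
pose H := [set z | dot z a = dot c a].
have HE z : H z -> dot (z - c) c = 0 by move=> Hz; apply: ac; rewrite dotBl Hz subrr.
have Hline (m : C) : H (c + m *: e) by rewrite /H /= dotDl dotZl ea mulr0 addr0.
have [x0 x0P] := symK a (dot c a) a0.
have HKp : (H `&` K) p by split => //; rewrite pE.
have HKq : (H `&` K) q by split => //; rewrite qE.
(* Rotation by -1 reflects [p] in [x0]. Both [p] and its image lie in [H], hence so does their
   midpoint [x0]. *)
have Hx0 : H x0.
  have := x0P p (-1) HKp; rewrite /sqmod reN imN re1 im1 oppr0 expr0n addr0 sqrrN.
  rewrite expr1n => /(_ erefl)[+ _] => /=; case: HKp => + _; rewrite /H /=.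
  rewrite dotDl dotZl dotBl mulN1r => -> h.
  have: (2%:R : C) * (dot x0 a - dot c a) = 0 
    by rewrite -(subrr (dot c a)) -{2}h; ring.
  by move/eqP; rewrite mulf_eq0 pnatr_eq0 /= subr_eq0 => /eqP.
pose d := x0 - c; have dc : dot d c = 0 by apply: HE.
(* The remaining terms are orthogonal to [c], so by Pythagoras |c|^2 cancels from the comparison
   with the unit ball. *)
have inB (m : C) : sqmod m = sqmod l -> (H `&` K) (c + m *: e) ->
    forall xi : C, sqmod xi = 1 -> nsq (d + xi *: (m *: e - d)) <= nsq (m *: e).
  move=> ml HKm xi xi1; have [Hy /KB] := x0P _ _ HKm xi1.
  have -> : x0 + xi *: (c + m *: e - x0) = c + (d + xi *: (m *: e - d)).
    rewrite /d addrA (addrC c) subrK; congr (_ + xi *: _).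
    by rewrite opprB addrA (addrC c).
  set y := d + _; have cy : dot c y = 0.
    rewrite dotC /y dotDl dc add0r dotZl dotBl dc dotZl (dotC c e) ce cj0.
    by rewrite mulr0 subr0 mulr0 cj0.
  rewrite nsqD cy re0 mulr0 addr0 => h.
  have := pyth m; rewrite ml -pyth -pE p1 nsqD dotZr ce mulr0 re0 mulr0 addr0.
  by lra.
have d0 : d = 0.
  apply: (center_unique ll); first by apply: inB => //; rewrite -pE.
  by apply: inB; rewrite -?qE.
have x0c : x0 = c by apply/eqP; rewrite -subr_eq0 -/d d0.
(* Now that the center is [c], the rotation by [xi] carries [p] to the third point. *)
rewrite zE; pose xi := (s + l) / l.
have xi1 : sqmod xi = 1 by rewrite sqmodM sqmodV -lsl divff // sqmod_eq0.
have [_] := x0P p xi HKp xi1.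
by rewrite x0c {1}pE (addrC c (l *: e)) addrK scalerA divfK.
Qed.

End Chains.

(** Take [A] of maximal rank with row space inside [P]. A vector of [P] outside it could be added to
    raise the rank, so [P] is exactly that row space; if it is proper, a nonzero column of the
    cokernel annihilates it. *)
Lemma subspace_full_or_annihilated (F : fieldType) (n : nat) (P : 'rV[F]_n -> Prop) :
  P 0 -> (forall u v, P u -> P v -> P (u + v)) -> (forall a u, P u -> P (a *: u)) ->
  (forall u, P u) \/ (exists2 a : 'cV[F]_n, a != 0 & forall u, P u -> u *m a = 0).
Proof.
move=> P0 PD PZ.
pose Q r := `[< exists A : 'M[F]_n, \rank A = r /\ forall u : 'rV_n, (u <= A)%MS -> P u >].
have exQ : exists r, Q r.
  exists 0%N; apply/asboolP; exists 0; split; first by rewrite mxrank0.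
  by move=> u /submx0null ->.
have leQ r : Q r -> (r <= n)%N.
  by move=> /asboolP[A [<- _]]; exact: rank_leq_row.
case: (ex_maxnP exQ leQ) => r /asboolP[A [rA AP]] rmax.
have PA u : P u -> (u <= A)%MS.
  move=> Pu; apply/negP => /negP uA.
  have /rmax : Q (\rank (A + u)%MS).
    apply/asboolP; exists (A + u)%MS; split => // w /sub_addsmxP[[B b] /= ->].
    apply: PD; first by apply: AP; rewrite submxMl.
    by rewrite (mx11_scalar b) mul_scalar_mx; exact: PZ.
  rewrite -rA leqNgt; apply/negP/negPn; apply: rank_ltmx.
  by rewrite /ltmx addsmxSl addsmx_sub submx_refl.
have [fA|nfA] := boolP (row_full A); first by left => u; apply: AP; exact: submx_full.
right; have cA : cokermx A != 0.
  by apply: contraNneq nfA => cA0; rewrite -col_leq_rank -subn_eq0 -mxrank_coker cA0 mxrank0.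
have [j jP] : exists j, col j (cokermx A) != 0.
  apply/not_existsP => h.
  move/eqP: cA; apply; apply/matrixP => i j; have /negP/negPn/eqP/colP/(_ i) := h j.
  by rewrite !mxE.
exists (col j (cokermx A)) => // u /PA; rewrite submxE => /eqP uA.
by rewrite colE mulmxA -colE uA; apply/colP => i; rewrite !mxE.
Qed.

(** * A chain-closed spanning subset of the sphere is the sphere *)

Section SphereFromChains.
Variables (R : realType) (n : nat).
Local Notation C := (Cfield R).
Local Notation Cn := 'rV[C]_n.
Implicit Types (u v w p q z : Cn).

Variable T : set Cn.
Hypothesis T_sphere : forall z, T z -> nsq z = 1.
Hypothesis T_chain : forall p q (s : C), T p -> T q -> p != q ->
  nsq (p + s *: (q - p)) = 1 -> T (p + s *: (q - p)).
Variable p : Cn.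
Hypothesis Tp : T p.

Let p1 : nsq p = 1. Proof. exact: T_sphere. Qed.

(* Directions, normalized by [dot v p = 1], of the chains of [T] through [p]. *)
Definition chain_direction v :=
  dot v p = 1 /\ forall s : C, nsq (p + s *: v) = 1 -> T (p + s *: v).

Lemma dot_direction_neq0 v : dot v p = 1 -> v != 0.
Proof. by move=> vp; apply: contra_eq_neq vp => ->; rewrite dot0l eq_sym oner_eq0. Qed.

(** Since <v, p> = 1, we have |p + v/w|^2 = 1 + (2 Re w + |v|^2)/|w|^2: inversion makes the sphere
    condition real affine in [w]. *)
Lemma sphere_inverse_param v (w : C) : dot v p = 1 -> w != 0 ->
  (nsq (p + w^-1 *: v) == 1) = (2 * re w + nsq v == 0).
Proof.
move=> vp w0; have sw : sqmod w != 0 by rewrite sqmod_eq0.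
rewrite nsqD p1 nsqZ dotZr dotC vp sqmodV.
rewrite (_ : cj (1 : C) = 1) ?mulr1; last by apply: complex_ext; rewrite !reimE ?oppr0.
have -> : re (cj w^-1) = re w / sqmod w.
  have -> : w^-1 = rc (sqmod w)^-1 * cj w.
    apply: (mulfI w0); rewrite mulrCA mul_cj -rcM mulVf // divff //.
  by rewrite cjM cj_rc cjK reM re_rc im_rc mul0r subr0 mulrC.
rewrite -subr_eq0 -(mulrI_eq0 _ (mulfI sw)).
by congr (_ == _); field.
Qed.

(** One point of [T] other than [p] on the line suffices: [T_chain] then supplies the whole
    chain. *)
Lemma chain_direction_exists v (s : C) :
  dot v p = 1 -> s != 0 -> T (p + s *: v) -> chain_direction v.
Proof.
move=> vp s0 Ts; split => // t t1; have v0 := dot_direction_neq0 vp.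
have -> : p + t *: v = p + (t / s) *: ((p + s *: v) - p).
  by rewrite (addrC p (s *: v)) addrK scalerA divfK.
apply: T_chain => //; last by rewrite (addrC p (s *: v)) addrK scalerA divfK.
by rewrite eq_sym -subr_eq0 (addrC p) addrK scaler_eq0 negb_or s0.
Qed.

(** As |z| = |p| = 1, the real part of <z - p, p> is -|z - p|^2/2. Hence every chord from [p] can be
    normalized to a direction. *)
Lemma dot_chord_neq0 z : nsq z = 1 -> z != p -> dot (z - p) p != 0.
Proof.
move=> z1 zp; apply: re_neq0; move: z1; rewrite -{1}(subrK p z) nsqD p1 => h.
have : nsq (z - p) != 0 by rewrite nsq_eq0 subr_eq0.
by apply: contra_neq => h'; move: h; rewrite h'; lra.
Qed.

Lemma chain_direction_of z : T z -> z != p ->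
  dot (z - p) p != 0 /\ chain_direction ((dot (z - p) p)^-1 *: (z - p)).
Proof.
move=> Tz zp; have k0 := dot_chord_neq0 (T_sphere Tz) zp.
split => //; apply: (@chain_direction_exists _ (dot (z - p) p)) => //.
  by rewrite dotZl mulVf.
by rewrite scalerA divff // scale1r addrC subrK.
Qed.

(** With z_i = p + v_i/w_i, the vector (1 - t) v1 + t v2 equals (1 - t) w1 (z1 - p) + t w2 (z2 - p),
    and these weights add up to [w]. *)
Lemma collinear_of_affine_inverse v1 v2 (w1 w2 t : C) (w := (1 - t) * w1 + t * w2) :
  w1 != 0 -> w2 != 0 -> w != 0 ->
  p + w^-1 *: ((1 - t) *: v1 + t *: v2) =
    (p + w1^-1 *: v1)
    + (t * w2 / w) *: ((p + w2^-1 *: v2) - (p + w1^-1 *: v1)).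
Proof.
rewrite /w => w10 w20 w0; apply/rowP => j; rewrite !mxE; field.
by rewrite w20 w10 w0.
Qed.

(* With w = 1/s the condition p + s v \in S becomes Re w = - |v|^2 / 2, and
   collinearity of three points p + v_i / w_i becomes affine in the w_i, so
   that the imaginary part of w1 is free to be adjusted. *)
Lemma chain_direction_line_nonreal v1 v2 (t : C) : im t != 0 ->
  chain_direction v1 -> chain_direction v2 ->
  chain_direction ((1 - t) *: v1 + t *: v2).
Proof.
move=> t0 D1 D2; have [vE|v12] := eqVneq v1 v2.
  by rewrite -vE -scalerDl subrK scale1r.
case: (D1) (D2) => [vp1 T1] [vp2 T2]; set v := _ + _.
have vp : dot v p = 1 by rewrite dotDl !dotZl vp1 vp2; ring.
have nv u : dot u p = 1 -> 0 < nsq u.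
  by move=> up; rewrite nsq_gt0 dot_direction_neq0.
pose w2 : C := rc (- nsq v2 / 2).
(* The solution of Re w = -|v|^2/2 for the imaginary part of [w1]; its coefficient is [im t], whence
   the restriction to nonreal [t]. *)
pose y := (- nsq v / 2 + (1 - re t) * (nsq v1 / 2) + re t * (nsq v2 / 2)) / im t.
pose w1 : C := Complex (- nsq v1 / 2) y.
pose w := (1 - t) * w1 + t * w2.
have rw1 : re w1 = - nsq v1 / 2 by [].
have rw2 : re w2 = - nsq v2 / 2 by [].
have rw : re w = - nsq v / 2.
  have iw1 : im w1 = y by [].
  have iw2 : im w2 = 0 by [].
  by rewrite /w reD !reM rw1 rw2 iw1 iw2 !(reD, imD, reN, imN, re1, im1) /y; field.
have v0 := nv _ vp; have := nv _ vp1; have := nv _ vp2 => v20 v10.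
have w0 : w != 0 by apply: re_neq0; rewrite rw lt_eqF //; lra.
have w10 : w1 != 0 by apply: re_neq0; rewrite rw1 lt_eqF //; lra.
have w20 : w2 != 0 by apply: re_neq0; rewrite rw2 lt_eqF //; lra.
have Tz1 : T (p + w1^-1 *: v1).
  by apply: T1; apply/eqP; rewrite sphere_inverse_param // rw1; apply/eqP; field.
have Tz2 : T (p + w2^-1 *: v2).
  by apply: T2; apply/eqP; rewrite sphere_inverse_param // rw2; apply/eqP; field.
have zS : nsq (p + w^-1 *: v) = 1.
  by apply/eqP; rewrite sphere_inverse_param // rw; apply/eqP; field.
apply: (@chain_direction_exists v w^-1) => //; first by rewrite invr_eq0.
set z1 := p + w1^-1 *: v1 in Tz1; set z2 := p + w2^-1 *: v2 in Tz2.
have zE : p + w^-1 *: v = z1 + (t * w2 / w) *: (z2 - z1).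
  exact: collinear_of_affine_inverse.
rewrite zE; apply: T_chain => //; last by rewrite -zE.
(* If the two points coincided, pairing with [p] would give w1 = w2 and then v1 = v2. *)
apply: contra_neq v12 => /addrI vv.
have := congr1 (fun u => dot u p) vv; rewrite /= !dotZl vp1 vp2 !mulr1 => ww.
by move: vv; rewrite ww => /scalerI -> //; rewrite invr_eq0.
Qed.

(** A real parameter t other than 0 is reached in two nonreal steps: first the point with parameter
    i, then, from [v1] towards that point, the parameter -i t. *)
Lemma chain_direction_line v1 v2 (t : C) :
  chain_direction v1 -> chain_direction v2 ->
  chain_direction ((1 - t) *: v1 + t *: v2).
Proof.
move=> D1 D2; have [t0|t0] := eqVneq (im t) 0; last exact: chain_direction_line_nonreal.
have [->|tn0] := eqVneq t 0; first by rewrite subr0 scale1r scale0r addr0.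
pose i : C := Complex 0 1.
have ii : i * i = -1 by apply: complex_ext; rewrite !reimE /=; ring.
have D3 : chain_direction ((1 - i) *: v1 + i *: v2).
  by apply: chain_direction_line_nonreal => //; rewrite oner_eq0.
have -> : (1 - t) *: v1 + t *: v2 =
    (1 - (- i * t)) *: v1 + (- i * t) *: ((1 - i) *: v1 + i *: v2).
  apply/rowP => j; rewrite !mxE.
  rewrite (_ : 1 - t = 1 + i * i * t); last by rewrite ii; ring.
  rewrite [in LHS](_ : t = - (i * i) * t); last by rewrite ii; ring.
  by ring: ii.
apply: chain_direction_line_nonreal => //.
rewrite !reimE /= t0 mulr0 add0r mulN1r oppr_eq0.
by apply: contra_neq tn0 => rt; apply: complex_ext.
Qed.

Hypothesis T_spanning : forall (a : Cn) (c : C), a != 0 ->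
  ~ (forall z, T z -> dot z a = c).

Lemma exists_chain_direction : exists v, chain_direction v.
Proof.
have [z [Tz zp]] : exists z, T z /\ z != p.
  apply/not_existsP => h; apply: (@T_spanning p 1).
    by rewrite -nsq_eq0 p1 oner_eq0.
  move=> z Tz; have [->|zp] := eqVneq z p; first by rewrite dotvv p1.
  by case: (h z).
by have [_ ?] := chain_direction_of Tz zp; eexists; eassumption.
Qed.

(** The directions form a complex affine subspace of {<v, p> = 1}. Either it is all of it, and every
    point of the sphere is reached, or it is annihilated by a functional that is then constant on
    [T], against [T_spanning]. *)
Lemma chain_closed_sphere z : nsq z = 1 -> T z.
Proof.
move=> z1; have [->//|zp] := eqVneq z p.
have [v1 D1] := exists_chain_direction; have vp1 : dot v1 p = 1 by case: D1.
pose V u := chain_direction (v1 + u).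
have VZ (a : C) u : V u -> V (a *: u).
  move=> Vu; rewrite /V.
  have -> : v1 + a *: u = (1 - a) *: v1 + a *: (v1 + u).
    by apply/rowP => j; rewrite !mxE; ring.
  exact: chain_direction_line.
have VD u v : V u -> V v -> V (u + v).
  move=> Vu Vv; rewrite /V.
  (* A sum is the midpoint of the two doubled vectors. *)
  have -> : v1 + (u + v) = (1 - 2^-1 : C) *: (v1 + (2 : C) *: u)
      + (2^-1 : C) *: (v1 + (2 : C) *: v).
    by apply/rowP => j; rewrite !mxE; field.
  by apply: chain_direction_line; exact: VZ.
(* Projecting along [v1] onto the orthogonal complement of [p] extends [V] to a linear subspace of
   [Cn] that also contains [v1]. *)
pose W u := V (u - dot u p *: v1).
have W1 v : dot v p = 1 -> W v = chain_direction v.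
  by move=> vp; rewrite /W /V vp scale1r addrC subrK.
have [full|[a a0 Wa]] : (forall u, W u) \/ exists2 a : 'cV_n, a != 0 & forall u, W u -> u *m a = 0.
  apply: subspace_full_or_annihilated.
  - by rewrite /W /V dot0l scale0r subrr addr0.
  - move=> u v Wu Wv; rewrite /W.
    have -> : u + v - dot (u + v) p *: v1 = (u - dot u p *: v1) + (v - dot v p *: v1).
      by rewrite dotDl scalerDl opprD addrACA.
    exact: VD Wu Wv.
  - move=> c u Wu; rewrite /W dotZl -scalerA -scalerBr; exact: VZ Wu.
- have k0 := dot_chord_neq0 z1 zp.
  have := full ((dot (z - p) p)^-1 *: (z - p)); rewrite W1; last by rewrite dotZl mulVf.
  case=> _ /(_ (dot (z - p) p)); rewrite scalerA divff // scale1r addrC subrK.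
  exact.
- have dota u : dot u (\row_j cj (a j 0)) = (u *m a) 0 0.
    by rewrite mxE; apply: eq_bigr => j _; rewrite mxE cjK.
  exfalso; apply: (@T_spanning (\row_j cj (a j 0)) (dot p (\row_j cj (a j 0)))).
    apply: contra_neq a0 => /rowP h; apply/colP => j.
    by have := h j; rewrite !mxE => /(congr1 (@cj R)); rewrite cjK cj0.
  move=> y Ty; have [->//|yp] := eqVneq y p.
  have [k0 Dy] := chain_direction_of Ty yp.
  have := Dy; rewrite -W1; last by case: Dy.
  move=> /Wa; rewrite -scalemxAl => /eqP; rewrite scaler_eq0 invr_eq0 (negPf k0) /=.
  move/eqP/matrixP => /(_ 0 0); rewrite -dota dotBl mxE => /eqP.
  by rewrite subr_eq0 => /eqP.
Qed.

End SphereFromChains.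

(** A point of the ball is r u with |u| = 1 and 0 <= r <= 1, and it lies on the segment from -u to
    u, where u has weight (1 + r)/2. *)
Lemma convex_ball_of_sphere (R : realType) (n : nat) (K : set 'rV[Cfield R]_n) :
  (0 < n)%N -> convex_set_Cn K -> (forall z, nsq z = 1 -> K z) ->
  forall z, nsq z <= 1 -> K z.
Proof.
move=> n0 Kc KS z z1.
have [u [u1 [r [r0 r1 ->]]]] : exists u, nsq u = 1 /\
    exists r : R, [/\ 0 <= r, r <= 1 & z = rc r *: u].
  have [->|z0] := eqVneq z 0.
    exists (delta_mx 0 (Ordinal n0)); split; last by exists 0; rewrite scale0r.
    rewrite nsqE (bigD1 (Ordinal n0)) //= mxE !eqxx sqmod1 big1 ?addr0 // => j /negPf jn.
    by rewrite mxE eqxx jn /sqmod re0 im0 expr0n addr0.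
  have r0 : 0 < Num.sqrt (nsq z) by rewrite sqrtr_gt0 nsq_gt0.
  have r2 : Num.sqrt (nsq z) ^+ 2 = nsq z by rewrite sqr_sqrtr ?nsq_ge0.
  exists (rc (Num.sqrt (nsq z))^-1 *: z); split.
    by rewrite nsqZ sqmod_rc exprVn r2 mulVf // nsq_eq0.
  exists (Num.sqrt (nsq z)); split; first exact: ltW.
    by rewrite -[leRHS]sqrtr1 ler_wsqrtr.
  by rewrite scalerA -rcM divff ?rc1 ?scale1r // gt_eqF.
have t01 : 0 <= (1 + r) / 2 <= 1 by lra.
have um : nsq (- u) = 1 by rewrite nsqN.
have := Kc _ _ (KS _ u1) (KS _ um) _ t01; rewrite -/(rc _); congr K.
rewrite scalerN -scalerBl; congr (_ *: _).
by apply: complex_ext; rewrite !reimE; field.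
Qed.

(** * Continuity and compactness over the complex field *)

Section Continuity.
Variables (R : realType) (X : topologicalType).
Local Notation C := (Cfield R).

Lemma continuous_bigsum (K : numFieldType) (I : Type) (r : seq I) (F : I -> X -> K) :
  (forall i, continuous (F i)) -> continuous (fun x => \sum_(i <- r) F i x).
Proof.
move=> cF x; elim: r => [|i r IH].
  by under eq_fun do rewrite big_nil; exact: cvg_cst.
under eq_fun do rewrite big_cons.
by apply: cvgD => //; exact: cF.
Qed.

Lemma continuous_bigprod (K : numFieldType) (I : Type) (r : seq I) (F : I -> X -> K) :
  (forall i, continuous (F i)) -> continuous (fun x => \prod_(i <- r) F i x).
Proof.
move=> cF x; elim: r => [|i r IH].
  by under eq_fun do rewrite big_nil; exact: cvg_cst.
under eq_fun do rewrite big_cons.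
by apply: cvgM => //; exact: cF.
Qed.

Lemma continuous_det (K : numFieldType) (n : nat) (F : X -> 'M[K]_n) :
  (forall i j, continuous (fun x => F x i j)) -> continuous (fun x => \det (F x)).
Proof.
move=> cF; apply: continuous_bigsum => s x.
by apply: cvgM; [exact: cvg_cst|apply: continuous_bigprod].
Qed.

Lemma rc_abs_le_norm (z : C) (x : R) : x ^+ 2 <= sqmod z -> rc `|x| <= `|z|.
Proof.
move=> h; rewrite normc_def lecR -sqrtr_sqr ler_wsqrtr //.
Qed.

Lemma continuous_re : continuous (@re R).
Proof.
move=> z; apply/(@cvgrPdist_lt _ _ _ (nbhs z) _) => e e0; apply/nbhs_normP.
exists (rc e) => [|w /= zw]; first by rewrite /= ltcR.
rewrite -ltcR; apply: le_lt_trans zw.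
by apply: rc_abs_le_norm; rewrite /sqmod !reimE lerDl sqr_ge0.
Qed.

Lemma continuous_im : continuous (@im R).
Proof.
move=> z; apply/(@cvgrPdist_lt _ _ _ (nbhs z) _) => e e0; apply/nbhs_normP.
exists (rc e) => [|w /= zw]; first by rewrite /= ltcR.
rewrite -ltcR; apply: le_lt_trans zw.
by apply: rc_abs_le_norm; rewrite /sqmod !reimE lerDr sqr_ge0.
Qed.

Lemma continuous_sqmod (F : X -> C) :
  continuous F -> continuous (fun x => sqmod (F x)).
Proof.
move=> cF x; have cre : (re (F y)) @[y --> x] --> re (F x).
  by apply: continuous_comp; [exact: cF|exact: continuous_re].
have cim : (im (F y)) @[y --> x] --> im (F x).
  by apply: continuous_comp; [exact: cF|exact: continuous_im].
by apply: cvgD; [exact: (cvgM cre cre)|exact: (cvgM cim cim)].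
Qed.

Lemma continuous_nsq (n : nat) (F : X -> 'rV[C]_n) :
  (forall j, continuous (fun x => F x 0 j)) -> continuous (fun x => nsq (F x)).
Proof.
move=> cF; under eq_fun do rewrite nsqE.
by apply: continuous_bigsum => j; apply: continuous_sqmod.
Qed.

End Continuity.

Lemma continuous_rc (R : realType) : continuous (@rc R).
Proof.
(* The radius [e] is a complex number; being positive means having zero imaginary part and positive
   real part. *)
move=> x; apply/(@cvgrPdist_lt _ _ _ (nbhs x) _) => e; rewrite ltcE /= => /andP[/eqP ei e0].
apply/nbhs_normP; exists (re e) => // y /= xy.
rewrite (_ : rc x - rc y = rc (x - y)); last first.
  by apply: complex_ext; rewrite !reimE ?subrr.
by rewrite normc_def /= expr0n addr0 sqrtr_sqr ltcE /= ei eqxx.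
Qed.

Lemma square_compact (R : realType) (L : R) :
  compact [set z : Cfield R | `|re z| <= L /\ `|im z| <= L].
Proof.
have sq : compact (`[- L, L] `*` `[- L, L]).
  by apply: compact_setX; exact: segment_compact.
pose i : Cfield R := Complex 0 1.
pose f (x : R * R) : Cfield R := rc x.1 + i * rc x.2.
suff -> : [set z : Cfield R | `|re z| <= L /\ `|im z| <= L] =
    f @` (`[- L, L] `*` `[- L, L]).
  apply: continuous_compact => //; apply: continuous_subspaceT => x.
  apply: cvgD; first by apply: continuous_comp; [exact: cvg_fst|exact: continuous_rc].
  apply: cvgM; first exact: cvg_cst.
  by apply: continuous_comp; [exact: cvg_snd|exact: continuous_rc].
have ref x : re (f x) = x.1 by rewrite /f !reimE /=; ring.
have imf x : im (f x) = x.2 by rewrite /f !reimE /=; ring.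
apply/seteqP; split => [z [rz iz]|_ [x [xL yL] <-]].
  exists (re z, im z); first by split; rewrite /= in_itv /= -ler_norml.
  by apply: complex_ext; rewrite ?ref ?imf.
by split; rewrite ?ref ?imf ler_norml; [move: xL|move: yL]; rewrite /= in_itv.
Qed.

Lemma box_compact (R : realType) (m : nat) (L : R) :
  compact [set x : 'rV[Cfield R]_m | forall j, `|re (x 0 j)| <= L /\ `|im (x 0 j)| <= L].
Proof.
exact: (rV_compact (fun=> @square_compact R L)).
Qed.

Lemma compact_max (R : realType) (X : topologicalType) (A : set X) (f : X -> R) :
  A !=set0 -> compact A -> continuous f ->
  exists2 c, A c & forall t, A t -> f t <= f c.
Proof.
move=> A0 cA cf; have [c /set_mem Ac h] := compact_EVT_max A0 cA (continuous_subspaceT cf).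
by exists c => // t At; apply: h; exact: mem_set.
Qed.

(** * Existence of a Loewner ellipsoid *)

Section Loewner.
Variables (R : realType) (n : nat).
Local Notation C := (Cfield R).
Local Notation Cn := 'rV[C]_n.
Implicit Types (K : set Cn) (z : Cn).

(** These n + 1 affinely independent points of [K] bound every affine map that sends [K] into the
    unit ball. *)
Lemma interior_basis K : K° !=set0 ->
  exists z0 (r : R), [/\ 0 < r, K z0 & forall i, K (z0 + rc r *: delta_mx 0 i)].
Proof.
case=> z0 Kz0; exists z0; move: (Kz0) => /nbhs_ballP[e /= e0 eK].
move: (e0); rewrite ltcE /= => /andP[/eqP ei re0]; exists (re e / 2); split.
- by rewrite divr_gt0.
- exact: interior_subset.
move=> i; apply: eK; split => // k j; rewrite !mxE -ball_normE /=.
rewrite opprD addrA subrr add0r normrN normc_def ltcE /= ei eqxx /=.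
have -> : (k == 0) = true by rewrite ord1.
case: (j == i); rewrite /= ?mulr1 ?mulr0 ?subr0 ?mul0r ?addr0 ?expr0n ?addr0.
  by rewrite sqrtr_sqr ger0_norm ?divr_ge0 ?ltW // ltr_pdivrMr // ltr_pMr // ltr1n.
by rewrite sqrtr0.
Qed.

Lemma nsqB_le (u v : Cn) : nsq (u - v) <= 2 * (nsq u + nsq v).
Proof.
have := nsq_ge0 (u + v).
by rewrite (nsqD u v) (nsqD u (- v)) nsqN dotNr reN; lra.
Qed.

Lemma sqmod_coord_le (u : Cn) j : sqmod (u 0 j) <= nsq u.
Proof.
by rewrite nsqE (bigD1 j) //= lerDl sumr_ge0 // => i _; exact: sqmod_ge0.
Qed.

Lemma det_scalar_neq0 (s : R) : s != 0 -> \det ((rc s)%:M : 'M[C]_n) != 0.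
Proof. by move=> s0; rewrite det_scalar expf_neq0 // rc_eq0. Qed.

(** The affine maps sending [K] into the ball form a closed bounded set, on which the continuous
    function |det|^2 has a maximum; a small homothety shows that it is positive. *)
Lemma loewner_ellipsoid K : compact K -> K° !=set0 ->
  exists (M : 'M[C]_n) (b : Cn), [/\ M \in unitmx,
    forall z, K z -> nsq (z *m M + b) <= 1 &
    forall (M' : 'M[C]_n) (b' : Cn),
      (forall z, K z -> nsq (z *m M' + b') <= 1) ->
      sqmod (\det M') <= sqmod (\det M)].
Proof.
move=> cK /interior_basis[z0 [r [r0 Kz0 Kr]]].
(* An affine map, written with base point [z0], is coded by one row vector holding its linear part
   and its value at [z0]. *)
pose lin (x : 'rV[C]_(n * n + n)) : 'M[C]_n := vec_mx (lsubmx x).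
pose tr (x : 'rV[C]_(n * n + n)) : Cn := rsubmx x.
have linE x i j : lin x i j = x 0 (lshift n (mxvec_index i j)) by rewrite !mxE.
have trE x j : tr x 0 j = x 0 (rshift (n * n) j) by rewrite mxE.
pose G := [set x | forall z, K z -> nsq ((z - z0) *m lin x + tr x) <= 1].
have Gmk M (b : Cn) : (forall z, K z -> nsq ((z - z0) *m M + b) <= 1) ->
    G (row_mx (mxvec M) b) /\ lin (row_mx (mxvec M) b) = M.
  by move=> h; rewrite /G /= /lin /tr row_mxKl row_mxKr mxvecK.
have clin i j : continuous (fun x => lin x i j).
  move=> x; rewrite (_ : (fun _ => _) =
    fun y : 'rV[C]_(n * n + n) => y 0 (lshift n (mxvec_index i j))).
    exact: coord_continuous.
  by apply/funext => y; rewrite linE.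
have ctr j : continuous (fun x => tr x 0 j).
  move=> x; rewrite (_ : (fun _ => _) =
    fun y : 'rV[C]_(n * n + n) => y 0 (rshift (n * n) j)).
    exact: coord_continuous.
  by apply/funext => y; rewrite trE.
have cG : closed G.
  rewrite (_ : G = \bigcap_(z in K) [set x | nsq ((z - z0) *m lin x + tr x) <= 1]).
    apply: closed_bigI => z _.
    have cf : continuous (fun x => nsq ((z - z0) *m lin x + tr x)).
      apply: continuous_nsq => j.
      rewrite (_ : (fun _ => _) = fun x => \sum_i (z - z0) 0 i * lin x i j + tr x 0 j); last first.
        by apply/funext => x; rewrite mxE [in LHS]mxE.
      have cs : continuous (fun x => \sum_i (z - z0) 0 i * lin x i j).
        apply: continuous_bigsum => i x.
        exact: (cvgM (cvg_cst _) (clin i j x)).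
      by move=> x; exact: (cvgD (cs x) (ctr j x)).
    by move/continuous_closedP: cf => /(_ _ (@closed_le R 1)).
  by apply/seteqP; split => x h z Kz; exact: (h z Kz).
(* A row of the linear part, times [r], is a difference of two vectors of the ball, so its squared
   norm is at most 4; the summand 1 covers the translation. *)
pose L2 := 4 / r ^+ 2 + 1.
have GL x : G x -> forall k, sqmod (x 0 k) <= L2.
  move=> Gx k; have h0 := Gx _ Kz0; rewrite subrr mul0mx add0r in h0.
  have r2 : 0 < r ^+ 2 by rewrite exprn_gt0.
  have r4 : 0 < 4 / r ^+ 2 by rewrite divr_gt0.
  case: (split_ordP k) => [k1|k2] ->; last first.
    rewrite -trE; apply: (le_trans (sqmod_coord_le _ _)).
    by rewrite /L2; lra.
  case/mxvec_indexP: k1 => i j; rewrite -linE.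
  have := Gx _ (Kr i); rewrite (addrC z0) addrK -scalemxAl -rowE => h1.
  have := nsqB_le (rc r *: row i (lin x) + tr x) (tr x).
  rewrite addrK nsqZ sqmod_rc => h2.
  have := sqmod_coord_le (row i (lin x)) j; rewrite mxE => h3.
  have h4 : r ^+ 2 * nsq (row i (lin x)) <= 4 by lra.
  have h5 : nsq (row i (lin x)) <= 4 / r ^+ 2 by rewrite ler_pdivlMr // mulrC.
  by rewrite /L2; lra.
have compG : compact G.
  apply: (subclosed_compact cG (@box_compact R _ (L2 + 1))) => x Gx k.
  have := GL _ Gx k; have : 0 <= L2 by rewrite addr_ge0 // divr_ge0 // exprn_ge0 // ltW.
  rewrite /sqmod; move: (re _) (im _) => a b L0 h.
  by split; rewrite ler_norml; apply/andP; split; nra.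
have [zm _ zmax] : exists2 c, K c & forall t, K t -> nsq (t - z0) <= nsq (c - z0).
  apply: (@compact_max R _ K (fun t => nsq (t - z0))) => //; first by exists z0.
  apply: continuous_nsq => j x.
  rewrite (_ : (fun _ => _) = fun t : Cn => t 0 j - z0 0 j); last first.
    by apply/funext => t; rewrite !mxE.
  exact: (cvgB (@coord_continuous _ 1 n 0 j x) (cvg_cst _)).
pose m := nsq (zm - z0); have m0 : 0 <= m by exact: nsq_ge0.
(* On [K], s^2 |z - z0|^2 <= m/(1 + m)^2 <= 1, so the homothety of ratio [s] is admissible. *)
pose s := (1 + m)^-1; have s0 : 0 < s by rewrite invr_gt0; lra.
have [Gs lins] : G (row_mx (mxvec (rc s)%:M) 0) /\ lin (row_mx (mxvec (rc s)%:M) 0) = (rc s)%:M.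
  apply: Gmk => z Kz; rewrite addr0 mul_mx_scalar nsqZ sqmod_rc.
  have := zmax _ Kz; rewrite -/m => zm1.
  have sm : s * (1 + m) = 1 by rewrite mulVf //; lra.
  have := nsq_ge0 (z - z0); nra.
have [x Gx xmax] : exists2 x, G x & forall y, G y -> sqmod (\det (lin y)) <= sqmod (\det (lin x)).
  apply: (@compact_max R _ G (fun x => sqmod (\det (lin x)))) => //.
    by exists (row_mx (mxvec (rc s)%:M) 0).
  by apply: continuous_sqmod; exact: continuous_det.
exists (lin x), (tr x - z0 *m lin x); split.
- have := xmax _ Gs; rewrite lins unitmxE unitfE => h.
  rewrite -sqmod_eq0 gt_eqF //; apply: lt_le_trans h.
  by rewrite lt_def sqmod_ge0 sqmod_eq0 det_scalar_neq0 // gt_eqF.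
- by move=> z /Gx; rewrite mulmxBl addrAC addrA.
- move=> M' b' h.
  have /Gmk[Gy <-] : forall z, K z -> nsq ((z - z0) *m M' + (z0 *m M' + b')) <= 1.
    by move=> z Kz; rewrite mulmxBl addrA subrK; exact: h.
  exact: xmax.
Qed.

End Loewner.

(** Where g < k the bound follows from f <= 1. Where g >= k, compactness keeps [f] below some
    constant less than 1, which leaves room for a small multiple of [g]. *)
Lemma penalized_le (R : realType) (X : topologicalType) (K : set X) (f g : X -> R) (k : R) :
  compact K -> continuous f -> continuous g -> 0 < k ->
  (forall z, K z -> 0 <= f z <= 1) -> (forall z, K z -> 0 <= g z) ->
  (forall z, K z -> f z = 1 -> g z = 0) ->
  exists e : R, [/\ 0 < e, e <= 1 & forall z, K z -> f z + e * g z <= 1 + k * e].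
Proof.
move=> cK cf cg k0 f01 g0 fg.
pose K' := K `&` [set z | k <= g z].
have [K'0|K'n] := pselect (K' !=set0); last first.
  exists 1; split => // z Kz; have := f01 _ Kz; rewrite mulr1 mul1r.
  have : g z < k by rewrite ltNge; apply/negP => kg; apply: K'n; exists z.
  by lra.
have cK' : compact K'.
  by apply: compact_closedI => //; move/continuous_closedP: cg => /(_ _ (@closed_ge R k)).
have [c [Kc kc] cmax] := compact_max K'0 cK' cf.
have [d Kd dmax] : exists2 d, K d & forall t, K t -> g t <= g d.
  by apply: compact_max => //; exists c.
have fc1 : f c < 1.
  have /andP[_] := f01 _ Kc; rewrite le_eqVlt => /orP[/eqP /(fg _ Kc) gc|//].
  by move: kc; rewrite /= gc; lra.
have gd := g0 _ Kd; have gd1 : 0 < 1 + g d by lra.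
have := f01 _ Kc => fc.
(* Here [f c] is the maximum of [f] where g >= k, and [g d] the maximum of [g] on [K]; thus f c + e
   g d <= 1. *)
exists ((1 - f c) / (1 + g d)); split.
- by rewrite divr_gt0 //; lra.
- by rewrite ler_pdivrMr //; lra.
set e := _ / _; have e0 : 0 < e by rewrite divr_gt0 //; lra.
have eE : e * (1 + g d) = 1 - f c by rewrite divfK // gt_eqF.
move=> z Kz; have := f01 _ Kz; have := g0 _ Kz; have := dmax _ Kz => h1 h2 h3.
have [kg|gk] := leP k (g z); last by nra.
have : f z <= f c by apply: cmax; split.
by nra.
Qed.

(** Compare the determinants of two block triangular factorizations of the same matrix. *)
Lemma det_rank1 (F : comNzRingType) (n : nat) (u : 'cV[F]_n) (v : 'rV[F]_n) :
  \det (1%:M + u *m v) = 1 + (v *m u) 0 0.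
Proof.
have e1 : block_mx 1%:M (- v) u 1%:M =
    block_mx 1%:M 0 u 1%:M *m block_mx 1%:M (- v) 0 (1%:M + u *m v) :> 'M[F]_(1 + n).
  rewrite mulmx_block !mul1mx !mul0mx mulmx1 !addr0 mulmxN.
  by congr block_mx; rewrite addrCA addNr addr0.
have e2 : block_mx 1%:M (- v) u 1%:M =
    block_mx 1%:M (- v) 0 1%:M *m block_mx (1%:M + v *m u) 0 u 1%:M :> 'M[F]_(1 + n).
  rewrite mulmx_block !mul1mx !mul0mx !mulmx1 !add0r !mulNmx.
  by congr block_mx; rewrite addrK.
have := congr1 determinant e1; rewrite {1}e2 !det_mulmx !det_lblock !det_ublock.
rewrite !det1 !mul1r !mulr1 => <-.
by rewrite [_ + _ in LHS]mx11_scalar det_scalar1 !mxE.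
Qed.

(** By convexity, the power lies below its chord over [0, 1]. *)
Lemma one_plus_exp_le (R : realFieldType) (n : nat) (x : R) :
  0 <= x <= 1 -> (1 + x) ^+ n <= 1 + (2 ^+ n - 1) * x.
Proof.
move=> x01; elim: n => [|n IH]; first by rewrite !expr0 subrr mul0r addr0.
have h2 : 1 <= (2 : R) ^+ n by rewrite exprn_ege1 // ler1n.
rewrite !exprS; move: IH h2; move: (_ ^+ n) (2 ^+ n) => A B IH h2.
have : (1 + x) * A <= (1 + x) * (1 + (B - 1) * x) by rewrite ler_wpM2l //; lra.
have : 0 <= (B - 1) * (x * (1 - x)) by rewrite !mulr_ge0 //; lra.
by lra.
Qed.

(** * Contact points of the Loewner ellipsoid *)

Section Contact.
Variables (R : realType) (n : nat).
Local Notation C := (Cfield R).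
Local Notation Cn := 'rV[C]_n.
Implicit Types (K : set Cn) (z a b y : Cn).

(** For a unit vector [a], this scales the direction [a] by [1 + h] and fixes its orthogonal
    complement. *)
Definition stretch a (h : R) : 'M[C]_n :=
  1%:M + (\col_j (rc h * cj (a 0 j))) *m a.

Lemma mul_stretch a h y : y *m stretch a h = y + (rc h * dot y a) *: a.
Proof.
rewrite mulmxDr mulmx1 mulmxA; congr (_ + _); rewrite [y *m _ in LHS]mx11_scalar mul_scalar_mx.
congr (_ *: _); rewrite mxE /dot mulr_sumr; apply: eq_bigr => j _.
by rewrite mxE mulrCA.
Qed.

Lemma det_stretch a h : nsq a = 1 -> \det (stretch a h) = rc (1 + h).
Proof.
move=> a1; rewrite det_rank1 rcD; congr (_ + _).
rewrite mxE; transitivity (rc h * dot a a); last by rewrite dotvv a1 mulr1.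
by rewrite /dot mulr_sumr; apply: eq_bigr => j _; rewrite mxE mulrCA.
Qed.

(* Completing the square: the left-hand side is |y'|^2 + |(1+h)t - s|^2 with
   t = <y, a>, y' the component of y orthogonal to a, s = e c / (1+h), and
   1 + e = (1+h)^2. *)
Lemma nsq_stretch_le a y (h : R) (c : C) (e := 2 * h + h ^+ 2) :
  nsq a = 1 -> 0 <= h ->
  nsq (y *m stretch a h - (rc (e / (1 + h)) * c) *: a)
    <= nsq y + e * sqmod (dot y a - c).
Proof.
move=> a1 h0; rewrite mul_stretch -addrA -scalerBl.
set k := e / (1 + h); set t := dot y a.
rewrite nsqD nsqZ a1 dotZr -/t mulr1 -addrA lerD2l.
have h1 : 0 < 1 + h by lra.
have kE : k * (1 + h) = e by rewrite divfK // gt_eqF.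
have e0 : 0 <= e by rewrite /e; nra.
have k2 : k ^+ 2 <= e.
  have : k ^+ 2 * (1 + e) = e ^+ 2 by rewrite -kE /e; move: kE; rewrite /e; nra.
  by nra.
rewrite /sqmod !reimE; move: (re t) (im t) (re c) (im c) => t1 t2 c1 c2.
(* The real and imaginary parts of [t] and [c] separate, each giving this one-variable
   inequality. *)
have main (x w : R) : (h * x - k * w) ^+ 2 + 2 * (h * x - k * w) * x <= e * (x - w) ^+ 2.
  have -> : (h * x - k * w) ^+ 2 + 2 * (h * x - k * w) * x =
      e * x ^+ 2 - 2 * (k * (1 + h)) * x * w + k ^+ 2 * w ^+ 2 by rewrite /e; ring.
  rewrite kE; have : k ^+ 2 * w ^+ 2 <= e * w ^+ 2 by rewrite ler_wpM2r // sqr_ge0.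
  by nra.
have := main t1 c1; have := main t2 c2.
by lra.
Qed.

Section MaximalDeterminant.
Variables (K : set Cn) (M : 'M[C]_n) (b : Cn).
Hypotheses (cK : compact K) (uM : M \in unitmx).
Hypothesis MK : forall z, K z -> nsq (z *m M + b) <= 1.
Hypothesis Mmax : forall (M' : 'M[C]_n) (b' : Cn),
  (forall z, K z -> nsq (z *m M' + b') <= 1) -> sqmod (\det M') <= sqmod (\det M).

Lemma continuous_affine_coord j : continuous (fun z : Cn => (z *m M + b) 0 j).
Proof.
rewrite (_ : (fun _ => _) = fun z : Cn => \sum_i z 0 i * M i j + b 0 j); last first.
  by apply/funext => z; rewrite mxE [in LHS]mxE.
have cs : continuous (fun z : Cn => \sum_i z 0 i * M i j).
  apply: continuous_bigsum => i z.
  exact: (cvgM (@coord_continuous _ 1 n 0 i z) (cvg_cst _)).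
by move=> z; exact: (cvgD (cs z) (cvg_cst _)).
Qed.

(** Stretching along [a] raises |y|^2 by at most e |<y, a> - c|^2, which would vanish at all contact
    points. The image then leaves the ball so little that shrinking by [rho] repairs it, while the
    determinant still grows. *)
Lemma contact_not_in_unit_hyperplane a (c : C) : nsq a = 1 ->
  ~ (forall z, K z -> nsq (z *m M + b) = 1 -> dot (z *m M + b) a = c).
Proof.
(* Chosen so that (1 + be h)^n <= 1 + (2^n - 1) be h < 1 + h. *)
move=> a1 hc; pose be : R := (2 ^+ n)^-1.
have be0 : 0 < be by rewrite invr_gt0 exprn_gt0.
have be1 : be <= 1 by rewrite invf_le1 ?exprn_gt0 // exprn_ege1 // ler1n.
have [e [e0 e1 he]] : exists e : R, [/\ 0 < e, e <= 1 & forall z, K z ->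
    nsq (z *m M + b) + e * sqmod (dot (z *m M + b) a - c) <= 1 + 2 * be / 3 * e].
  apply: (@penalized_le R _ K (fun z => nsq (z *m M + b))
    (fun z => sqmod (dot (z *m M + b) a - c))) => //.
  - by apply: continuous_nsq; exact: continuous_affine_coord.
  - apply: continuous_sqmod.
    have cd : continuous (fun z => dot (z *m M + b) a).
      apply: continuous_bigsum => j z.
      exact: (cvgM (@continuous_affine_coord j z) (cvg_cst _)).
    by move=> z; exact: (cvgB (cd z) (cvg_cst _)).
  - by rewrite divr_gt0 // mulr_gt0.
  - by move=> z Kz; rewrite nsq_ge0 MK.
  - by move=> z _; exact: sqmod_ge0.
  - by move=> z Kz /(hc _ Kz) ->; rewrite subrr /sqmod re0 im0 expr0n addr0.
(* Then 2 h + h^2 <= 3 h = e, and the bound 1 + (2 be/3) e equals 1 + 2 be h, which is at most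
   rho^2. *)
pose h := e / 3; have h0 : 0 < h by rewrite divr_gt0.
have h1 : h <= 1 by rewrite /h; lra.
pose rho := 1 + be * h; have bh : 0 < be * h by rewrite mulr_gt0.
have rho0 : 0 < rho by rewrite /rho; lra.
pose s := rc ((2 * h + h ^+ 2) / (1 + h)) * c.
pose M' := rc rho^-1 *: (M *m stretch a h).
pose b' := rc rho^-1 *: (b *m stretch a h - s *: a).
have /Mmax : forall z, K z -> nsq (z *m M' + b') <= 1.
  move=> z Kz.
  have -> : z *m M' + b' = rc rho^-1 *: ((z *m M + b) *m stretch a h - s *: a).
    by rewrite -scalemxAr -scalerDr mulmxA mulmxDl addrA.
  rewrite nsqZ sqmod_rc exprVn ler_pdivrMl ?exprn_gt0 // mulr1.
  apply: (le_trans (nsq_stretch_le _ c a1 (ltW h0))).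
  have := he _ Kz; have := sqmod_ge0 (dot (z *m M + b) a - c).
  have eE : e = 3 * h by rewrite /h; field.
  move: (nsq _) (sqmod _) => A B B0; rewrite eE => AB.
  have : (2 * h + h ^+ 2) * B <= 3 * h * B by rewrite ler_wpM2r //; nra.
  rewrite /rho; nra.
rewrite detZ det_mulmx det_stretch // !sqmodM sqmodX !sqmod_rc mulrCA.
have dM : 0 < sqmod (\det M).
  by rewrite lt_def sqmod_ge0 sqmod_eq0 -unitfE -unitmxE uM.
rewrite ger_pMr // -exprM mulnC exprM exprVn -exprVn -exprMn => hle.
have p0 : 0 < rho ^+ n by rewrite exprn_gt0.
have q0 : 0 <= rho^-1 ^+ n * (1 + h).
  by rewrite mulr_ge0 ?exprn_ge0 ?invr_ge0 ?(ltW rho0) //; lra.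
move: hle; rewrite expr_le1 // exprVn ler_pdivrMl // mulr1 => hr.
have : rho ^+ n <= 1 + (2 ^+ n - 1) * (be * h).
  by apply: one_plus_exp_le; apply/andP; split; nra.
have : 2 ^+ n * be = 1 by rewrite divff // gt_eqF // exprn_gt0.
nra.
Qed.

Lemma contact_not_in_hyperplane a (c : C) : a != 0 ->
  ~ (forall z, K z -> nsq (z *m M + b) = 1 -> dot (z *m M + b) a = c).
Proof.
move=> a0 hc; pose r := Num.sqrt (nsq a).
have r0 : 0 < r by rewrite sqrtr_gt0 nsq_gt0.
have r2 : r ^+ 2 = nsq a by rewrite sqr_sqrtr ?nsq_ge0.
apply: (@contact_not_in_unit_hyperplane (rc r^-1 *: a) (rc r^-1 * c)).
  by rewrite nsqZ sqmod_rc exprVn r2 mulVf // nsq_eq0.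
by move=> z Kz z1; rewrite dotZr cj_rc (hc _ Kz z1).
Qed.

End MaximalDeterminant.

(** Complex affine maps commute with rotations about corresponding centers and carry hyperplanes to
    hyperplanes. *)
Lemma circled_affine_preimage K (M : 'M[C]_n) b : M \in unitmx ->
  (forall a (c : C), a != 0 -> circled ([set z | dot z a = c] `&` K)) ->
  forall a (c : C), a != 0 ->
    circled ([set z | dot z a = c] `&` [set y | K ((y - b) *m invmx M)]).
Proof.
move=> uM symK a c a0.
(* The adjoint of [M] applied to [a]: the normal of the pulled-back hyperplane. *)
pose a' : Cn := \row_i \sum_j cj (M i j) * a 0 j.
have adj z : dot (z *m M) a = dot z a'.
  rewrite /dot; under eq_bigr do rewrite mxE mulr_suml.
  rewrite exchange_big; apply: eq_bigr => i _.
  rewrite mxE cj_sum mulr_sumr; apply: eq_bigr => j _.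
  by rewrite cjM cjK mulrA.
have a'0 : a' != 0.
  apply: contra_neq a0 => a'0; apply/eqP; rewrite -nsq_eq0 /nsq.
  by rewrite -{1}(mulmxKV uM a) adj a'0 dot0r.
have [x0 x0P] := symK a' (c - dot b a) a'0.
exists (x0 *m M + b) => y xi [/= ya Ky] xi1.
have [|h1 h2] := x0P ((y - b) *m invmx M) xi _ xi1.
  by split => //=; rewrite -adj mulmxKV // dotBl ya.
set w := x0 + _ in h1 h2.
have wE : x0 *m M + b + xi *: (y - (x0 *m M + b)) = w *m M + b.
  rewrite /w mulmxDl -scalemxAl mulmxBl mulmxKV // addrAC.
  by rewrite opprD (addrC (- _)) addrA.
split; rewrite /= wE; last by rewrite addrK mulmxK.
by rewrite dotDl adj h1 subrK.
Qed.

End Contact.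

(** * The characterization of complex ellipsoids *)

Unset Implicit Arguments.

Theorem theorem4p3 (R : realType) (n : nat) (K : set 'rV[Cfield R]_n) :
  (2 <= n)%N ->
  convex_body K ->
  (forall H : set 'rV[Cfield R]_n, complex_hyperplane H -> symmetric_set (H `&` K)%classic) ->
  complex_ellipsoid K.
Proof.
move=> n2 [convK cK intK] symK; have n0 : (0 < n)%N by exact: leq_trans n2.
have [M [b [uM MK Mmax]]] := loewner_ellipsoid cK intK.
(* The image of [K] under z -> z M + b, written as a preimage under the inverse map. *)
pose K1 := [set y | K ((y - b) *m invmx M)].
have K1f z : K z -> K1 (z *m M + b) by rewrite /K1 /= addrK mulmxK.
have fg y : (y - b) *m invmx M *m M + b = y by rewrite mulmxKV // subrK.
have symK1 := circled_affine_preimage b uM (fun a c a0 =>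
  circled_symmetric_set (symK _ (complex_hyperplane_dot c a0))).
have K1B y : K1 y -> nsq y <= 1 by move=> /MK; rewrite fg.
pose T := [set y | K1 y /\ nsq y = 1].
have T_spanning a (c : Cfield R) : a != 0 -> ~ (forall y, T y -> dot y a = c).
  move=> a0 h; apply: (contact_not_in_hyperplane cK uM MK Mmax (c := c) a0) => z Kz z1.
  by apply: h; split => //; exact: K1f.
(* An empty [T] would lie in every hyperplane. *)
have [p Tp] : exists p, T p.
  apply/not_existsP => h; pose i := Ordinal n0.
  apply: (T_spanning (delta_mx 0 i) 0) => [|y /h //].
  by apply/eqP => /rowP /(_ i) /eqP; rewrite !mxE !eqxx /= oner_eq0.
have T_chain q r (s : Cfield R) : T q -> T r -> q != r ->
    nsq (q + s *: (r - q)) = 1 -> T (q + s *: (r - q)).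
  move=> [Kq q1] [Kr r1] qr z1; split => //.
  exact: (chain_closed n2 symK1 K1B).
have K1S y : nsq y = 1 -> K1 y.
  move=> y1; suff : T y by case.
  by apply: (@chain_closed_sphere _ _ T _ T_chain p Tp T_spanning) => // z [].
have convK1 : convex_set_Cn K1.
  move=> x y Kx Ky t t01; have := convK _ _ Kx Ky t t01; rewrite /K1 /=; congr K.
  rewrite !scalemxAl -mulmxDl; congr (_ *m _).
  rewrite !scalerBr addrACA -opprD -scalerDl (addrC _ (1 - _)).
  by rewrite subrK scale1r.
exists (invmx M), (- (b *m invmx M)); split; first by rewrite unitmx_inv.
rewrite unit_ballE; apply/seteqP; split => [z Kz|_ [v /= v1 <-]].
  exists (z *m M + b); first exact: MK.
  by rewrite mulmxDl mulmxK // addrK.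
rewrite -mulmxBl; exact: (convex_ball_of_sphere n0 convK1 K1S).
Qed.
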